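(* Let $n$ be a positive integer. Then $$\min\{|S| : S\subseteq\{0,1,\dots,n\}\text{ and }S+S=\{0,1,\dots,2n\}\}\le2\sqrt{2n}+1.$$ Consequently, for any field $k$ and the $n$th Veronese subring $R^{(n)}=k[x^iy^{n-i}\mid0\le i\le n]$ of $R=k[x,y]$, we have $\operatorname{cs}(R^{(n)})\le2\sqrt{2n}+1$.
   Context: $S+S=\{s+t:s,t\in S\}$. $R^{(n)}$ is a standard graded $k$-algebra in which each generator $x^iy^{n-i}$ has degree one; its homogeneous maximal ideal is $\mathfrak m=(x^iy^{n-i}\mid0\le i\le n)$. For a standard graded $k$-algebra $A$ with homogeneous maximal ideal $\mathfrak m$ and a homogeneous ideal $I$, $\mu(I)=\dim_k(I/\mathfrak mI)$, and $\operatorname{cs}(A)=\min\{\mu(I): I\subseteq\mathfrak m \text{ a homogeneous ideal with } I^2=\mathfrak m^2\}$. *)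

(* Defs.v *)
From HB Require Import structures.
From mathcomp Require Import all_boot all_order all_algebra.
From mathcomp Require Import finmap.
From mathcomp Require Import boolp classical_sets reals.
From mathcomp Require Import mpoly.

Set Implicit Arguments.
Unset Strict Implicit.
Unset Printing Implicit Defensive.

Import Order.TTheory GRing.Theory Num.Theory.

Local Open Scope classical_set_scope.
Local Open Scope ring_scope.

(* [is_min P c] also asserts that the minimum exists, i.e. that [P] is
   inhabited. *)
Definition is_min (P : set nat) (c : nat) : Prop :=
  P c /\ forall d, P d -> (c <= d)%N.

Definition range0 (n : nat) : {fset nat} := [fset i | i in iota 0 n.+1]%fset.

Definition sumset (S : {fset nat}) : {fset nat} :=
  [fset (s + t)%N | s in S, t in S]%fset.

(* Evaluation of a polynomial over [k] at a finite family of elements of a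
   commutative [k]-algebra. *)
Definition alg_eval (k : fieldType) (A : comAlgType k) (r : nat)
    (g : 'I_r -> A) (P : {mpoly k[r]}) : A :=
  mmap (fun c : k => c%:A) g P.

Record std_graded_alg (k : fieldType) := StdGradedAlg {
  sga_sort :> comAlgType k;
  piece : nat -> set sga_sort;
  piece_lin : forall d,
    piece d 0 /\
    forall (c : k) a b, piece d a -> piece d b -> piece d (c *: a + b);
  piece_mul : forall d e a b, piece d a -> piece e b -> piece (d + e)%N (a * b);
  piece_decomp : forall a, exists N (f : nat -> sga_sort),
    (forall d, piece d (f d)) /\ a = \sum_(d < N) f d;
  piece_direct : forall N (f : nat -> sga_sort),
    (forall d, piece d (f d)) -> \sum_(d < N) f d = 0 ->
    forall d, (d < N)%N -> f d = 0;
  piece_zero : piece 0%N = [set c%:A | c in [set: k]];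
  piece_std : exists r (g : 'I_r -> sga_sort),
    (forall i, piece 1%N (g i)) /\ forall a, exists P, a = alg_eval g P
}.

Section Ideals.
Variables (k : fieldType) (A : std_graded_alg k).
Implicit Types I J : set A.

Definition ideal I : Prop :=
  [/\ I 0, forall a b, I a -> I b -> I (a + b) & forall a b, I b -> I (a * b)].

Definition homogeneous I : Prop :=
  forall a, I a -> exists N (f : nat -> A),
    (forall d, I (f d) /\ piece d (f d)) /\ a = \sum_(d < N) f d.

(* The homogeneous maximal ideal: the sum of the pieces of positive degree. *)
Definition hmax : set A :=
  [set a | exists N (f : nat -> A),
     (forall d, piece d.+1 (f d)) /\ a = \sum_(d < N) f d].

Definition ideal_mul I J : set A :=
  [set a | exists s : seq (A * A),
     (forall x, x \in s -> I x.1 /\ J x.2) /\ a = \sum_(x <- s) x.1 * x.2].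

End Ideals.

Arguments hmax {k} A.

(* [quot_dim U W d]: for subspaces [W `<=` U], the quotient [U / W] has a
   basis of [d] vectors, namely the classes of the [b i]. *)
Definition quot_dim (k : fieldType) (V : lmodType k) (U W : set V) (d : nat) :
    Prop :=
  exists b : 'I_d -> V,
    [/\ forall i, U (b i),
        forall u, U u -> exists c : 'I_d -> k, W (u - \sum_i c i *: b i)
      & forall c : 'I_d -> k, W (\sum_i c i *: b i) -> forall i, c i = 0].

Definition has_mu (k : fieldType) (A : std_graded_alg k) (I : set A) (d : nat) :
    Prop :=
  quot_dim I (ideal_mul (hmax A) I) d.

(* [is_cs A c]: the invariant cs(A) is [c]. *)
Definition is_cs (k : fieldType) (A : std_graded_alg k) (c : nat) : Prop :=
  is_min [set d | exists I : set A,
            [/\ ideal I, homogeneous I, I `<=` hmax A,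
                ideal_mul I I = ideal_mul (hmax A) (hmax A)
              & has_mu I d]] c.

Section Veronese.
Variables (k : fieldType) (n : nat).

Definition vgen (i : 'I_n.+1) : {mpoly k[2]} :=
  'X_ord0 ^+ i * 'X_ord_max ^+ (n - i).

Definition vgens : n.+1.-tuple {mpoly k[2]} := [tuple vgen i | i < n.+1].

Definition veronese_pred : {pred {mpoly k[2]}} :=
  [pred p | `[< exists P : {mpoly k[n.+1]}, p = P \mPo vgens >]].

Lemma veronese_predP p :
  reflect (exists P : {mpoly k[n.+1]}, p = P \mPo vgens) (p \in veronese_pred).
Proof. by rewrite inE; apply: asboolP. Qed.

Lemma veronese_subalg : subalg_closed veronese_pred.
Proof.
split=> [|c p q /veronese_predP[P ->] /veronese_predP[Q ->]
         |p q /veronese_predP[P ->] /veronese_predP[Q ->]].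
- by apply/veronese_predP; exists 1; rewrite comp_mpoly1.
- by apply/veronese_predP; exists (c *: P + Q); rewrite comp_mpolyD comp_mpolyZ.
- by apply/veronese_predP; exists (P * Q); rewrite rmorphM.
Qed.

HB.instance Definition _ :=
  GRing.isSubalgClosed.Build k {mpoly k[2]} veronese_pred veronese_subalg.

Record veronese := Veronese { vval : {mpoly k[2]}; _ : vval \in veronese_pred }.

HB.instance Definition _ := [isSub for vval].
HB.instance Definition _ := [Choice of veronese by <:].
HB.instance Definition _ := [SubChoice_isSubComNzRing of veronese by <:].
HB.instance Definition _ := [SubZmodule_isSubLmodule of veronese by <:].
HB.instance Definition _ := [SubNzRing_SubLmodule_isSubLalgebra of veronese by <:].
HB.instance Definition _ := [SubLalgebra_isSubAlgebra of veronese by <:].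


Lemma vvalE (a : veronese) : exists P : {mpoly k[n.+1]}, vval a = P \mPo vgens.
Proof. by apply/veronese_predP; case: a. Qed.

Lemma mem_mPo (P : {mpoly k[n.+1]}) : P \mPo vgens \in veronese_pred.
Proof. by apply/veronese_predP; exists P. Qed.

Definition veval (P : {mpoly k[n.+1]}) : veronese := Veronese (mem_mPo P).

(* The generators x^i y^(n-i), as elements of the Veronese ring. *)
Definition vX (i : 'I_n.+1) : veronese := veval 'X_i.

Lemma val_vX i : vval (vX i) = vgen i.
Proof. by rewrite /= comp_mpolyXU -tnth_nth tnth_mktuple. Qed.

(* The grading in which each generator x^i y^(n-i) has degree one. *)
Definition vpiece (d : nat) : set veronese :=
  [set a | exists P : {mpoly k[n.+1]}, P \is d.-homog /\ a = veval P].

Lemma vevalP (a : veronese) : exists P, a = veval P.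
Proof. by have [P aP] := vvalE a; exists P; apply: val_inj. Qed.

Lemma veval_linear : linear veval.
Proof. by move=> c P Q; apply: val_inj; rewrite /= comp_mpolyD comp_mpolyZ. Qed.

HB.instance Definition _ :=
  GRing.isLinear.Build k {mpoly k[n.+1]} veronese _ veval veval_linear.

Lemma veval_monoid : monoid_morphism veval.
Proof.
by split=> [|P Q]; apply: val_inj; rewrite /= ?comp_mpoly1 ?rmorphM.
Qed.

HB.instance Definition _ :=
  GRing.isMonoidMorphism.Build {mpoly k[n.+1]} veronese veval veval_monoid.

Lemma vgen_homog i : vgen i \is n.-homog.
Proof.
have := dhomogM (dhomogMn i (_ : 'X_ord0 \is 1.-homog))
  (dhomogMn (n - i) (_ : 'X_ord_max \is 1.-homog)).
rewrite !mul1n subnKC ?leq_ord //; apply; rewrite dhomogX; exact/eqP/mdeg1.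
Qed.

Lemma vpiece_homog d a : vpiece d a -> vval a \is (n * d)%N.-homog.
Proof.
move=> [P [/dhomogP hP ->]] /=; rewrite comp_mpolyEX big_seq.
apply: rpred_sum => m /hP /= <-; apply: rpredZ; rewrite comp_mpolyX mdegE.
rewrite big_distrr /=; elim/big_ind2: _ => //; first exact: dhomog1.
  by move=> p d1 q d2 hp hq; apply: dhomogM.
by move=> i _; rewrite tnth_mktuple; apply/dhomogMn/vgen_homog.
Qed.

Lemma vpiece_lin d :
  vpiece d 0 /\
  forall (c : k) a b, vpiece d a -> vpiece d b -> vpiece d (c *: a + b).
Proof.
split=> [|c a b [P [hP ->]] [Q [hQ ->]]].
  by exists 0; rewrite linear0 rpred0.
by exists (c *: P + Q); rewrite linearP; split=> //; apply: rpredD => //; apply: rpredZ.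
Qed.

Lemma vpiece_mul d e a b :
  vpiece d a -> vpiece e b -> vpiece (d + e)%N (a * b).
Proof.
move=> [P [hP ->]] [Q [hQ ->]]; exists (P * Q).
by rewrite rmorphM; split=> //; apply: dhomogM.
Qed.

Lemma vpiece_decomp a : exists N (f : nat -> veronese),
  (forall d, vpiece d (f d)) /\ a = \sum_(d < N) f d.
Proof.
have [P ->] := vevalP a.
exists (msize P), (fun d => veval (pihomog mdeg d P)); split=> [d|].
  by exists (pihomog mdeg d P); split=> //; apply: pihomogP.
by rewrite -linear_sum -pihomog_partitionE.
Qed.

Lemma vpiece_direct : (0 < n)%N -> forall N (f : nat -> veronese),
  (forall d, vpiece d (f d)) -> \sum_(d < N) f d = 0 ->
  forall d, (d < N)%N -> f d = 0.
Proof.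
move=> n_gt0 N f hf /(congr1 vval) sum0 d ltdN; apply: val_inj => /=.
have := congr1 (pihomog mdeg (n * d)) sum0.
rewrite [vval _](raddf_sum (\val : veronese -> _)) /= !linear0 linear_sum /=.
rewrite (bigD1 (Ordinal ltdN)) //= big1 ?addr0; last first.
  move=> i; rewrite -val_eqE /= => ne_id.
  apply: pihomog_ne0 (vpiece_homog (hf i)).
  by rewrite eqn_pmul2l.
by rewrite (pihomog_dE (vpiece_homog (hf d))).
Qed.

Lemma vpiece_zero : vpiece 0 = [set c%:A | c in [set: k]].
Proof.
apply/seteqP; split=> a /= => [[P [hP ->]]|[c _ <-]]; last first.
  by exists c%:A; rewrite linearZ /= rmorph1 rpredZ ?dhomog1.
exists P@_0%MM => //; rewrite -(rmorph1 veval) -linearZ /=; congr veval.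
rewrite [RHS]mpolyE -mpolyX0 (bigID (pred1 0%MM)) /= [X in _ + X]big_seq_cond.
rewrite [X in _ + X]big1 ?addr0 => [|m /andP[mP]]; last first.
  by move/dhomogP: hP => /(_ m mP) hm; rewrite -mdeg_eq0 hm.
have [P0|nP0] := boolP (0%MM \in msupp P).
  by rewrite -big_filter filter_pred1_uniq // big_seq1.
rewrite (memN_msupp_eq0 nP0) scale0r big_seq_cond big1 // => m /andP[mP /eqP m0].
by rewrite -m0 mP in nP0.
Qed.

Lemma veval_alg_eval P : veval P = alg_eval vX P.
Proof.
rewrite {1}[P]mpolyE linear_sum; apply: eq_bigr => m _.
rewrite linearZ /= mulr_algl; congr (_ *: _).
rewrite mpolyXE_id rmorph_prod; apply: eq_bigr => i _; exact: rmorphXn.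
Qed.

Lemma vpiece_std : exists r (g : 'I_r -> veronese),
  (forall i, vpiece 1 (g i)) /\ forall a, exists P, a = alg_eval g P.
Proof.
exists n.+1, vX; split=> [i|a].
  by exists 'X_i; split=> //; rewrite dhomogX; apply/eqP/mdeg1.
by have [P ->] := vevalP a; exists P; apply: veval_alg_eval.
Qed.

Definition veronese_alg (n_gt0 : (0 < n)%N) : std_graded_alg k :=
  StdGradedAlg vpiece_lin vpiece_mul vpiece_decomp (vpiece_direct n_gt0)
    vpiece_zero vpiece_std.

(* The homogeneous maximal ideal is generated by the x^i y^(n-i). *)
Lemma hmax_veronese (n_gt0 : (0 < n)%N) :
  hmax (veronese_alg n_gt0) =
  [set a | exists c : 'I_n.+1 -> veronese, a = \sum_i c i * vX i].
Proof.
apply/seteqP; split=> a /= => [[N [f [hf ->]]]|[c ->]].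
  elim/big_ind: _ => [|x y [c ->] [c' ->]|d _].
  - by exists (fun=> 0); rewrite big1 // => i _; rewrite mul0r.
  - exists (fun i => c i + c' i); rewrite -big_split /=.
    by apply: eq_bigr => i _; rewrite mulrDl.
  have [P [/dhomogP hP ->]] := hf d; rewrite [P]mpolyE linear_sum /= big_seq.
  elim/big_ind: _ => [|x y [c ->] [c' ->]|m /hP /= mdegm].
  - by exists (fun=> 0); rewrite big1 // => i _; rewrite mul0r.
  - exists (fun i => c i + c' i); rewrite -big_split /=.
    by apply: eq_bigr => i _; rewrite mulrDl.
  have [i m_i] : exists i, (m i != 0)%N.
    apply/existsP; rewrite -negb_forall; apply: contraPN mdegm => /forallP m0.
    by rewrite mdegE big1 // => i _; apply/eqP.
  exists (fun j => if j == i then veval (P@_m *: 'X_[m - U_(i)]) else 0).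
  rewrite (bigD1 i) //= eqxx big1 ?addr0 => [|j /negPf->]; last by rewrite mul0r.
  rewrite -rmorphM -scalerAl -mpolyXD submK //.
  by rewrite lep1mP.
have vX1 i : vpiece 1 (vX i).
  by exists 'X_i; split=> //; rewrite dhomogX; apply/eqP/mdeg1.
suff sumP (s : seq 'I_n.+1) : exists N (f : nat -> veronese),
    (forall d, vpiece d.+1 (f d)) /\ \sum_(i <- s) c i * vX i = \sum_(d < N) f d.
  exact: sumP.
have ext M N (f : nat -> veronese) : (M <= N)%N ->
    \sum_(d < M) f d = \sum_(d < N) if (d < M)%N then f d else 0.
  by move=> leMN; rewrite (big_ord_widen N) // big_mkcond.
have pif d b (f : nat -> veronese) : vpiece d.+1 (f d) ->
    vpiece d.+1 (if b then f d else 0).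
  by case: b => // _; case: (vpiece_lin d.+1).
elim: s => [|i s [N [f [hf eqf]]]].
  exists 0%N, (fun=> 0); rewrite big_nil big_ord0; split=> // d.
  by case: (vpiece_lin d.+1).
have [M [g [hg eqg]]] := vpiece_decomp (c i).
pose h d := (if (d < M)%N then g d * vX i else 0) + (if (d < N)%N then f d else 0).
exists (maxn M N), h; split=> [d|].
  rewrite /h -[X in X + _]scale1r; apply: (vpiece_lin d.+1).2.
    apply: (pif d (d < M)%N (fun d => g d * vX i)).
    by rewrite -addn1; apply: vpiece_mul.
  exact: (pif d (d < N)%N f).
rewrite big_cons eqf eqg mulr_suml /h big_split /=.
by rewrite (ext _ (maxn M N) (fun d => g d * vX i)) ?leq_maxl //
  (ext _ (maxn M N) f) ?leq_maxr.
Qed.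

End Veronese.

Arguments veronese_alg k {n} n_gt0.

(* Main.v *)
(** Let [S] consist of the intervals [0, s - 1] and [n - s + 1, n] and of the
    terms of the progression [j s - 1] lying in [0, n]. The progression has
    step [s], so its sum with the first interval covers [0, n] and its sum with
    the second one covers [n, 2 n]; moreover [|S| <= 2 s + (n + 1) / s - 2],
    and [s] close to [sqrt (n / 2)] gives the bound.

    For the Veronese ring, the ideal [I] generated by the [x^i y^(n-i)] with
    [i] in [S] satisfies [I^2 = m^2], because the product of two generators
    depends only on the sum of their indices. These monomials form a basis of
    [I / m I]: they span it since [A = k + m], and they are independent since
    they have degree [n] in [x, y] while [m I] starts in degree [2 n]. *)

Require Import Defs.
From mathcomp Require Import all_boot all_order all_algebra.
From mathcomp Require Import finmap.
From mathcomp Require Import boolp classical_sets reals.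
From mathcomp Require Import mpoly zify.

Set Implicit Arguments.
Unset Strict Implicit.
Unset Printing Implicit Defensive.

Import Order.TTheory GRing.Theory Num.Theory.

Local Open Scope classical_set_scope.
Local Open Scope ring_scope.

(** * Minima and finite sets of integers *)

Lemma is_min_exists (P : set nat) (d : nat) :
  P d -> exists c, is_min P c /\ (c <= d)%N.
Proof.
move=> Pd; have exP : exists m, `[< P m >] by exists d; apply/asboolP.
case: (ex_minnP exP) => c /asboolP Pc cmin.
by exists c; split=> [|]; [split=> // e Pe|]; apply/cmin/asboolP.
Qed.

Lemma mem_range0 n i : (i \in range0 n) = (i <= n)%N.
Proof. by rewrite in_fset mem_iota. Qed.

Lemma mem_sumset (S : {fset nat}) x :
  reflect (exists s t, [/\ s \in S, t \in S & x = (s + t)%N]) (x \in sumset S).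
Proof.
apply: (iffP idP) => [/imfset2P[s sS [t tS ->]]|[s [t [sS tS ->]]]].
  by exists s, t.
exact: in_imfset2.
Qed.

(** * A small additive basis of [0, n] *)

Section Basis.
Variables (n s : nat).
Hypotheses (s_gt0 : (0 < s)%N) (le_2s : (2 * s <= n.+1)%N).

Definition basis : {fset nat} :=
  [fset i | i in iota 0 n.+1 & [|| i < s, n < i + s | s %| i.+1]%N]%fset.

Lemma mem_basis i :
  (i \in basis) = (i <= n)%N && [|| i < s, n < i + s | s %| i.+1]%N.
Proof. by rewrite !inE mem_iota; case: i. Qed.

Lemma basis_sub : fsubset basis (range0 n).
Proof. by apply/fsubsetP => i; rewrite mem_basis mem_range0 => /andP[]. Qed.

Lemma basis_sumset : sumset basis = range0 (2 * n).
Proof.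
apply/fsetP => x; rewrite mem_range0; apply/mem_sumset/idP.
  by case=> a [b []]; rewrite !mem_basis => /andP[? _] /andP[? _] ->; lia.
move=> le_x.
have [le_xn|lt_nx] := leqP x n.
  have [lt_xs|le_sx] := ltnP x s.
    by exists x, 0%N; rewrite !mem_basis lt_xs s_gt0 le_xn addn0.
  (* With x + 1 = q s + r, one has x = (q s - 1) + r and r < s. *)
  exists (x.+1 %/ s * s).-1, (x.+1 %% s)%N.
  have q_gt0 : (0 < x.+1 %/ s * s)%N by rewrite muln_gt0 divn_gt0 // ltnW.
  have r_lt := ltn_pmod x.+1 s_gt0.
  have := divn_eq x.+1 s; split; last by lia.
    by rewrite mem_basis prednK // dvdn_mull // !orbT andbT; lia.
  by rewrite mem_basis r_lt andbT; lia.
(* Write x - n + s = q s + r; the shift by s makes q positive. Then x = (n - (s - r - 1)) + (q s -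
   1), provided q s - 1 <= n. *)
set y := (x - n + s)%N.
have r_lt := ltn_pmod y s_gt0; have yE := divn_eq y s.
have [le_qn|lt_nq] := leqP (y %/ s * s) n.+1.
  exists (n - (s - (y %% s).+1))%N, (y %/ s * s).-1.
  have q_gt0 : (0 < y %/ s * s)%N.
    by rewrite muln_gt0 divn_gt0 // leq_addl.
  split; last by rewrite /y in yE r_lt q_gt0 le_qn *; lia.
    rewrite mem_basis; apply/andP; split; first by lia.
    by apply/or3P/Or32; lia.
  by rewrite mem_basis prednK // dvdn_mull // !orbT andbT; lia.
(* Here q s - 1 exceeds n, which forces x - n into the last interval. *)
exists n, (x - n)%N; rewrite !mem_basis leqnn; split.
- by apply/or3P/Or32; lia.
- apply/andP; split; first by lia.
  by apply/or3P/Or32; rewrite /y in yE; lia.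
- by lia.
Qed.

Lemma card_basis : (#|` basis| <= 2 * s + n.+1 %/ s - 2)%N.
Proof.
(* The first and the last term of the progression already lie in the two intervals, which saves
   2. *)
pose c := [seq (j * s).-1 | j <- iota 2 (n.+1 %/ s - 2)].
pose l := iota 0 s ++ iota (n.+1 - s) s ++ c.
have q_ge2 : (2 <= n.+1 %/ s)%N by rewrite leq_divRL.
have -> : (2 * s + n.+1 %/ s - 2)%N = size l.
  by rewrite !size_cat size_map !size_iota; lia.
apply: uniq_leq_size (fset_uniq basis) _ => i.
rewrite mem_basis => /andP[le_in].
rewrite !mem_cat !mem_iota add0n leq0n.
have [lt_is //|ge_is] := ltnP i s.
have [?|le_isn] := ltnP n (i + s).
  by rewrite (_ : (n.+1 - s <= i < n.+1 - s + s)%N) ?orbT //; lia.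
move=> /dvdnP[j jE]; apply/or3P/Or33.
apply/mapP; exists j; last by rewrite -jE.
have j_gt1 : (1 < j)%N by rewrite ltnNge; apply/negP => ?; nia.
rewrite mem_iota j_gt1 subnKC //= leq_divRL //; nia.
Qed.

End Basis.

(* Taking [s] maximal with [2 s^2 <= n + 1] nearly minimizes
   [2 s + (n + 1) / s]; the minimum is near [s = sqrt (n / 2)]. *)
Lemma small_basis n : (0 < n)%N ->
  exists S : {fset nat}, [/\ fsubset S (range0 n), sumset S = range0 (2 * n)
    & ((#|` S| - 1) ^ 2 <= 8 * n)%N].
Proof.
move=> n_gt0.
have exs : exists s, (2 * s ^ 2 <= n.+1)%N by exists 1%N.
have ubs s : (2 * s ^ 2 <= n.+1)%N -> (s <= n.+1)%N by rewrite -mulnn; nia.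
case: (ex_maxnP exs ubs) => s les maxs.
have s_gt0 : (0 < s)%N by apply: maxs; rewrite exp1n muln1.
have lts : (n.+1 < 2 * s.+1 ^ 2)%N.
  by rewrite ltnNge; apply/negP => /maxs; rewrite ltnn.
rewrite -!mulnn in les lts.
have le_2s : (2 * s <= n.+1)%N by nia.
exists (basis n s); split; [exact: basis_sub|exact: basis_sumset|].
have := card_basis s_gt0 le_2s.
have := divn_eq n.+1 s; have := ltn_pmod n.+1 s_gt0.
move: #|` _| (n.+1 %/ s)%N (n.+1 %% s)%N => N q r lt_rs nE leN.
rewrite -mulnn.
(* [n + 1 < 2 (s + 1)^2] leaves only a bounded excess [e]. *)
have [e [qE e_le5]] : exists e, q = (2 * s + e)%N /\ (e <= 5)%N.
  by exists (q - 2 * s)%N; split; nia.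
have {}leN : (N - 1 <= 4 * s + e - 3)%N by lia.
apply: leq_trans (leq_mul leN leN) _.
have -> : (8 * n = 8 * (2 * s * s + e * s + r) - 8)%N by rewrite qE in nE; nia.
(* Expanding the square leaves (e - 3)^2 + 8 <= 24 s + 8 r, which holds for e <= 5 and s >= 1.
   Splitting on e makes it a constant. *)
by clear qE leN; do 6?[case: e e_le5 => [|e] e_le5; first by nia].
Qed.

(** Squaring c - 1 <= 2 sqrt (2 n) gives the integer inequality. The case c = 0, where the
    subtraction truncates, is separate. *)
Lemma natr_le_sqrt_bound (R : realType) n c :
  ((c - 1) ^ 2 <= 8 * n)%N -> c%:R <= 2 * Num.sqrt (2 * n%:R) + 1 :> R.
Proof.
case: c => [|c]; first by rewrite addr_ge0 ?mulr_ge0 ?sqrtr_ge0.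
rewrite subn1 -natr1 lerD2r => le_c.
rewrite -(ler_pXn2r (_ : 0 < 2)%N) ?nnegrE ?mulr_ge0 ?sqrtr_ge0 //.
rewrite exprMn sqr_sqrtr ?mulr_ge0 // mulrA -!natrX -!natrM ler_nat.
exact: le_c.
Qed.

(** * Graded algebras and products of ideals *)

Section GradedAlgebra.
Variables (k : fieldType) (A : std_graded_alg k).

(** The component of degree zero is a scalar, and the others lie in m. *)
Lemma hmax_decomp (a : A) : exists c : k, hmax A (a - c%:A).
Proof.
have [[|N] [f [hf ->]]] := piece_decomp a.
  exists 0, 0%N, (fun d => f d.+1); split=> [d|]; first exact: hf.
  by rewrite !big_ord0 scale0r subr0.
have := hf 0%N; rewrite piece_zero => -[c _ cE].
exists c, N, (fun d => f d.+1); split=> [d|]; first exact: hf.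
by rewrite big_ord_recl -cE addrAC subrr add0r.
Qed.

Lemma ideal_mulS (I I' J J' : set A) : I `<=` I' -> J `<=` J' ->
  ideal_mul I J `<=` ideal_mul I' J'.
Proof.
move=> II' JJ' a [s [sP ->]]; exists s; split=> // x /sP[? ?].
by split; [apply: II'|apply: JJ'].
Qed.

Lemma ideal_mul0 (I J : set A) : ideal_mul I J 0.
Proof. by exists [::]; rewrite big_nil. Qed.

Lemma ideal_mulD (I J : set A) a b :
  ideal_mul I J a -> ideal_mul I J b -> ideal_mul I J (a + b).
Proof.
move=> [s [sP ->]] [t [tP ->]]; exists (s ++ t); rewrite big_cat; split=> // x.
by rewrite mem_cat => /orP[/sP|/tP].
Qed.

Lemma ideal_mul_sum (I J : set A) (T : Type) (r : seq T) (P : pred T) F :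
  (forall i, P i -> ideal_mul I J (F i)) ->
  ideal_mul I J (\sum_(i <- r | P i) F i).
Proof.
move=> FP; elim/big_ind: _ => //; [exact: ideal_mul0|exact: ideal_mulD].
Qed.

Lemma ideal_mulM (I J : set A) a b : I a -> J b -> ideal_mul I J (a * b).
Proof.
move=> Ia Jb; exists [:: (a, b)]; rewrite big_seq1; split=> // x.
by rewrite inE => /eqP->.
Qed.

(** Padding with zeros lets finitely many elements be decomposed up to a common length. *)
Lemma piece_decomp_ge (a : A) : exists N (f : nat -> A),
  (forall d, piece d (f d)) /\
  forall M, (N <= M)%N -> a = \sum_(d < M) f d.
Proof.
have [N [f [hf aE]]] := piece_decomp a.
exists N, (fun d => if (d < N)%N then f d else 0); split=> [d|M leNM].
  by case: ifP => // _; case: (piece_lin A d).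
by rewrite aE (big_ord_widen M) // big_mkcond.
Qed.

Lemma piece_sum d (T : Type) (r : seq T) (P : pred T) (F : T -> A) :
  (forall i, P i -> piece d (F i)) -> piece d (\sum_(i <- r | P i) F i).
Proof.
have [p0 pD] := piece_lin A d.
move=> FP; elim/big_ind: _ => // x y px py.
by rewrite -[x]scale1r; apply: pD.
Qed.

End GradedAlgebra.

(** * Order of a polynomial at the origin *)

Section LowOrder.
Variables (r : nat) (R : comNzRingType).
Implicit Types p q : {mpoly R[r]}.

(* [p] has order at least [d] at the origin. *)
Definition mvanish d p : Prop :=
  forall m : 'X_{1..r}, (mdeg m < d)%N -> p@_m = 0.

Lemma mvanish_sum d (T : Type) (s : seq T) (P : pred T) F :
  (forall i, P i -> mvanish d (F i)) -> mvanish d (\sum_(i <- s | P i) F i).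
Proof. by move=> FP m md; rewrite raddf_sum big1 //= => i /FP; apply. Qed.

Lemma mvanishM d e p q : mvanish d p -> mvanish e q -> mvanish (d + e) (p * q).
Proof.
move=> vp vq m md; rewrite mcoeffM big1 // => -[a b] /= /eqP mE.
have [/vp->|le_d] := ltnP (mdeg a) d; first by rewrite mul0r.
rewrite vq ?mulr0 //; rewrite mE mdegD in md; lia.
Qed.

Lemma dhomog_mvanish d p : p \is d.-homog -> mvanish d p.
Proof. by move=> ph m md; apply: (dhomog_nemf_coeff ph); rewrite ltn_eqF. Qed.

End LowOrder.

(** * The monomial ideal of a set of generators *)

Section VeroneseIdeal.
Variables (k : fieldType) (n : nat) (n_gt0 : (0 < n)%N) (T : {set 'I_n.+1}).

Let V := veronese_alg k n_gt0.

Lemma vvalM (a b : veronese k n) : vval (a * b) = vval a * vval b.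
Proof. exact: (rmorphM (\val : veronese k n -> _)). Qed.

Lemma vval_sum (I : Type) (r : seq I) (P : pred I) (F : I -> veronese k n) :
  vval (\sum_(i <- r | P i) F i) = \sum_(i <- r | P i) vval (F i).
Proof. exact: (raddf_sum (\val : veronese k n -> _)). Qed.

Lemma vvalZ (c : k) (a : veronese k n) : vval (c *: a) = c *: vval a.
Proof. by []. Qed.

Definition monomial_ideal : set V :=
  [set a | exists c : 'I_n.+1 -> V, a = \sum_(i in T) c i * vX k i].

Lemma piece_vX (i : 'I_n.+1) : @piece k V 1 (vX k i).
Proof. by exists 'X_i; split=> //; rewrite dhomogX; apply/eqP/mdeg1. Qed.

Lemma monomial_idealP : ideal monomial_ideal.
Proof.
split=> [|_ _ [c ->] [d ->]|a _ [c ->]].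
- by exists (fun=> 0); rewrite big1 // => i _; rewrite mul0r.
- exists (fun i => c i + d i); rewrite -big_split /=.
  by apply: eq_bigr => i _; rewrite mulrDl.
- exists (fun i => a * c i); rewrite mulr_sumr.
  by apply: eq_bigr => i _; rewrite mulrA.
Qed.

Lemma monomial_ideal_vX i : i \in T -> monomial_ideal (vX k i).
Proof.
move=> iT; exists (fun j => (j == i)%:R).
rewrite (bigD1 i) //= eqxx mul1r big1 ?addr0 // => j /andP[_ /negPf->].
by rewrite mul0r.
Qed.

Lemma monomial_ideal_sub_hmax : monomial_ideal `<=` hmax V.
Proof.
move=> _ [c ->]; rewrite hmax_veronese.
exists (fun i => if i \in T then c i else 0); rewrite big_mkcond /=.
by apply: eq_bigr => i _; case: ifP; rewrite ?mul0r.
Qed.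

Lemma monomial_ideal_homogeneous : homogeneous monomial_ideal.
Proof.
move=> _ [c ->].
have /choice[N /choice[g gP]] i := piece_decomp_ge (c i).
(* The generators have degree one, so degrees of coefficients shift by one. *)
pose f d := if d is d'.+1 then \sum_(i in T) g i d' * vX k i else 0 : V.
exists (\max_i N i).+1, f; split=> [[|d]|] /=.
- by split; [case: monomial_idealP|case: (piece_lin V 0)].
- split; first by exists (fun i => g i d).
  apply: (@piece_sum _ V) => i _; rewrite -addn1; apply: (@piece_mul _ V); last exact: piece_vX.
  exact: (gP i).1.
- rewrite big_ord_recl add0r exchange_big /=; apply: eq_bigr => i _.
  by rewrite -mulr_suml -(gP i).2 // leq_bigmax.
Qed.

Lemma monomial_ideal_sqr :
  (forall i j : 'I_n.+1, exists s t,
     [/\ s \in T, t \in T & (i + j = s + t :> nat)%N]) ->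
  ideal_mul monomial_ideal monomial_ideal = ideal_mul (hmax V) (hmax V).
Proof.
move=> TT; apply/seteqP; split=> [|_ [l [lP ->]]].
  by apply: ideal_mulS; apply: monomial_ideal_sub_hmax.
rewrite big_seq; apply: ideal_mul_sum => x /lP[].
rewrite hmax_veronese => -[c ->] [d ->].
rewrite mulr_suml; apply: ideal_mul_sum => i _.
rewrite mulr_sumr; apply: ideal_mul_sum => j _.
have [s [t [sT tT stE]]] := TT i j.
have vXE : vX k i * vX k j = vX k s * vX k t :> V.
  apply: val_inj; rewrite [LHS]vvalM [RHS]vvalM !val_vX /vgen.
  rewrite mulrACA [RHS]mulrACA -!exprD stE; congr (_ * 'X_ _ ^+ _).
  have := leq_ord i; have := leq_ord j; have := leq_ord s; have := leq_ord t.
  by lia.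
rewrite mulrACA vXE mulrA; apply: ideal_mulM; last exact: monomial_ideal_vX.
by case: monomial_idealP => _ _; apply; apply: monomial_ideal_vX.
Qed.

Lemma hmax_mvanish (a : V) : hmax V a -> mvanish n (vval a).
Proof.
rewrite hmax_veronese => -[c ->].
rewrite vval_sum.
apply: mvanish_sum => i _; rewrite vvalM val_vX.
by apply: (@mvanishM _ _ 0 n) => //; apply/dhomog_mvanish/vgen_homog.
Qed.

(** These coefficient functionals are dual to the generators; they prove independence below. *)
Lemma mcoeff_vgen (i j : 'I_n.+1) :
  (vgen k i)@_(U_(ord0) *+ j + U_(ord_max) *+ (n - j)) = (i == j)%:R.
Proof.
rewrite /vgen !mpolyXn -mpolyXD mcoeffX; congr (nat_of_bool _)%:R.
apply/eqP/eqP => [/mnmP/(_ ord0)|-> //].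
by rewrite !mnmDE !mulmnE !mnm1E /= !mul0n !mul1n !addn0 => /val_inj.
Qed.

Lemma monomial_ideal_mu : has_mu monomial_ideal #|T|.
Proof.
exists (fun i => vX k (enum_val i)); split=> [i|_ [c ->]|c].
- exact/monomial_ideal_vX/enum_valP.
(* Replacing each coefficient by its scalar part changes the sum by an element of m I. *)
- have /choice[e eP] i := hmax_decomp (c i).
  exists (fun i => e (enum_val i)).
  rewrite -(big_enum_val (fun i => e i *: vX k i)) -sumrB.
  apply: ideal_mul_sum => i iT; rewrite -mulr_algl -mulrBl.
  by apply: ideal_mulM => //; apply: monomial_ideal_vX.
- move=> [l [lP /(congr1 (@vval k n)) sumE]] i.
  set i' := enum_val i.
  pose m := (U_(ord0) *+ i' + U_(ord_max) *+ (n - i') : 'X_{1..2})%MM.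
  have <- : (vval (\sum_j c j *: vX k (enum_val j) : V))@_m = c i.
    rewrite vval_sum raddf_sum (eq_bigr (fun j => c j * (j == i)%:R)).
      rewrite (bigD1 i) //= eqxx mulr1 big1 ?addr0 // => j /negPf->.
      by rewrite mulr0.
    move=> j _; rewrite -(inj_eq enum_val_inj) -mcoeff_vgen.
    by rewrite -mcoeffZ -val_vX -vvalZ.
  (* Since I is contained in m, both factors of each product in m I have order at least n. The
     monomial [m] has degree n < 2 n. *)
  have van : mvanish (n + n) (vval (\sum_j c j *: vX k (enum_val j) : V)).
    rewrite sumE vval_sum big_seq.
    apply: mvanish_sum => x /lP[/hmax_mvanish ? /monomial_ideal_sub_hmax].
    by move=> /hmax_mvanish ?; rewrite [vval _]vvalM; apply: mvanishM.
  apply: van; rewrite mdegD !mdegMn !mdeg1; have := leq_ord i'; lia.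
Qed.

End VeroneseIdeal.

(** * From sets of integers to sets of generators, and the two bounds *)

Lemma sumset_fset_of_ord n (S : {fset nat}) :
  fsubset S (range0 n) -> sumset S = range0 (2 * n) ->
  exists T : {set 'I_n.+1}, #|T| = #|` S| /\
    forall i j : 'I_n.+1, exists s t,
      [/\ s \in T, t \in T & (i + j = s + t :> nat)%N].
Proof.
move=> /fsubsetP S_n SS; exists [set i : 'I_n.+1 | val i \in S]%SET; split.
  rewrite [in RHS](_ : S =
      [fset val i | i in [set i : 'I_n.+1 | val i \in S]%SET]%fset).
    by rewrite card_imfset /= -?cardE //; apply: val_inj.
  apply/fsetP => x; apply/idP/imfsetP => [xS|[i /= + ->]]; last by rewrite inE.
  have /S_n := xS; rewrite mem_range0 => lt_xn.
  by exists (Ordinal (lt_xn : x < n.+1)%N) => //=; rewrite inE.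
move=> i j; have /mem_sumset[s [t [sS tS stE]]] : (i + j)%N \in sumset S.
  rewrite SS mem_range0; have := leq_ord i; have := leq_ord j; lia.
have lt_n u : u \in S -> (u < n.+1)%N by move=> /S_n; rewrite mem_range0.
by exists (Ordinal (lt_n _ sS)), (Ordinal (lt_n _ tS)); rewrite !inE.
Qed.

Theorem proposition4p18 (R : realType) (n : nat) (n_gt0 : (0 < n)%N) :
  (exists c : nat,
     is_min [set d | exists S : {fset nat},
               [/\ fsubset S (range0 n), sumset S = range0 (2 * n)
                 & d = #|` S|]] c /\
     c%:R <= 2 * Num.sqrt (2 * n%:R) + 1 :> R) /\
  (forall k : fieldType, exists c : nat,
     is_cs (veronese_alg k n_gt0) c /\
     c%:R <= 2 * Num.sqrt (2 * n%:R) + 1 :> R).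
Proof.
have [S [S_n SS le_S]] := small_basis n_gt0.
have [T [cardT TT]] := sumset_fset_of_ord S_n SS.
(* One value serves both minima: it suffices that the size of [S] is attained in each case. *)
have minbound (P : set nat) : P #|` S| ->
    exists c, is_min P c /\ c%:R <= 2 * Num.sqrt (2 * n%:R) + 1 :> R.
  move=> /is_min_exists[c [cmin le_c]]; exists c; split=> //.
  apply: natr_le_sqrt_bound; apply: leq_trans le_S.
  by rewrite leq_exp2r // leq_sub2r.
split=> [|k]; apply: minbound; first by exists S.
rewrite -cardT; exists (@monomial_ideal k n n_gt0 T); split.
- exact: monomial_idealP.
- exact: monomial_ideal_homogeneous.
- exact: monomial_ideal_sub_hmax.
- exact: monomial_ideal_sqr.
- exact: monomial_ideal_mu.
Qed.
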